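(* Let $F$ be a totally real number field with adele ring $\mathbb{A}$, let $\omega$ be a unitary Hecke character of $\mathbb{A}^\times/F^\times$, and let $\varphi\in\mathcal{S}(\mathbb{A}^2)$ be a Schwartz-Bruhat function. Then for every $z\in\mathbb{A}^\times$ (viewed as the scalar matrix $z\cdot 1_2$) and every $g\in\mathrm{GL}_2(\mathbb{A})$, $$E^{\rm ana}_{\omega,s}(\varphi)(zg)=\omega(z)\,E^{\rm ana}_{\omega,s}(\varphi)(g),$$ as an identity between meromorphic functions of $s$.
   Context: $|\cdot|$ is the idelic norm. $\mathcal{S}(\mathbb{A}^2)$ is the space of complex-valued Schwartz-Bruhat functions on $\mathbb{A}^2$ (column vectors). For $\Re(s)>1$, $$E^{\rm ana}_{\omega,s}(\varphi)(g)=|\det g|^{-s}\int_{\mathbb{A}^\times/F^\times}\omega(t)|t|^{2s}\,\Theta(\varphi)(t^{-1}g)\,d^\times t,\qquad \Theta(\varphi)(g)=\sum_{v\in F^2\setminus\{0\}}\varphi(g^{-1}v),$$ where an idele $t$ is identified with the scalar matrix $t\cdot 1_2$; this converges absolutely for $\Re(s)>1$, and for other $s$ the notation denotes the meromorphic continuation to $\mathbb{C}$ (which exists). $d^\times t$ is a fixed Haar measure on $\mathbb{A}^\times$, with the quotient measure on $\mathbb{A}^\times/F^\times$. *)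

(* Defs.v *)
From HB Require Import structures.
From mathcomp Require Import all_boot all_order all_algebra all_field.
From mathcomp Require Import ring_quotient complex.
From mathcomp Require Import all_classical all_reals all_analysis.

Set Implicit Arguments.
Unset Strict Implicit.
Unset Printing Implicit Defensive.

Import Order.TTheory GRing.Theory Num.Theory.
Import numFieldNormedType.Exports.

Local Open Scope classical_set_scope.
Local Open Scope complex_scope.
Local Open Scope ring_scope.

Definition totally_real (R : realType) (F : fieldExtType rat) : Prop :=
  forall (s : {rmorphism F -> R[i]}) (x : F), complex.Im (s x) = 0.

(* A finite place is given by its normalized absolute value: the one whose    *)
(* value at a uniformizer is 1/q, with q the order of the residue field.      *)
(* Every class of nontrivial nonarchimedean absolute values of F contains     *)
(* exactly one of these, so this type is in bijection with the primes of F.   *)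
Record finite_place (F : fieldExtType rat) (R : realType) := FinitePlace {
  pabs :> F -> R;
  pabs_ge0 : forall x, 0 <= pabs x;
  pabs_eq0 : forall x, (pabs x == 0) = (x == 0);
  pabsM : forall x y, pabs (x * y) = pabs x * pabs y;
  pabs_ultra : forall x y, pabs (x + y) <= Num.max (pabs x) (pabs y);
  pabs_normalized : exists q : nat,
    (exists r : 'I_q -> F,
       [/\ forall i, pabs (r i) <= 1,
           forall i j, pabs (r i - r j) < 1 -> i = j &
           forall x, pabs x <= 1 -> exists i, pabs (x - r i) < 1]) /\
    (exists w : F, pabs w = q%:R^-1 /\
       forall x, pabs x < 1 -> pabs x <= q%:R^-1) }.

HB.instance Definition _ (F : fieldExtType rat) (R : realType) :=
  gen_eqMixin (finite_place F R).
HB.instance Definition _ (F : fieldExtType rat) (R : realType) :=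
  gen_choiceMixin (finite_place F R).

(* For a totally real field these are all the archimedean places, and the     *)
(* completion at each of them is R.                                           *)
Definition real_place (F : fieldExtType rat) (R : realType) :=
  {rmorphism F -> R}.

HB.instance Definition _ (F : fieldExtType rat) (R : realType) :=
  gen_eqMixin (real_place F R).
HB.instance Definition _ (F : fieldExtType rat) (R : realType) :=
  gen_choiceMixin (real_place F R).

(* The completion of F at a finite place: Cauchy sequences modulo null        *)
(* sequences.                                                                 *)
Section Completion.
Variables (F : fieldExtType rat) (R : realType) (v : finite_place F R).

Lemma pabs0 : v 0 = 0.
Proof. by apply/eqP; rewrite pabs_eq0. Qed.

Lemma pabs1 : v 1 = 1.
Proof.
have /eqP : v 1 * v 1 = v 1 by rewrite -pabsM mulr1.
rewrite -subr_eq0 -{3}[v 1]mulr1 -mulrBr mulf_eq0 pabs_eq0 oner_eq0 /=.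
by rewrite subr_eq0 => /eqP.
Qed.

Lemma pabsN x : v (- x) = v x.
Proof.
have vN1 : v (-1) = 1.
  have /eqP : v (-1) * v (-1) = 1 by rewrite -pabsM mulrNN mulr1 pabs1.
  rewrite -expr2 sqrf_eq1 => /orP[/eqP //|/eqP vE].
  by have := pabs_ge0 v (-1); rewrite vE oppr_ge0 ler10.
by rewrite -mulN1r pabsM vN1 mul1r.
Qed.

Lemma pabsB x y : v (x - y) = v (y - x).
Proof. by rewrite -pabsN opprB. Qed.

Lemma pabs_ltD x y e : v x < e -> v y < e -> v (x + y) < e.
Proof.
by move=> xe ye; rewrite (le_lt_trans (pabs_ultra _ _ _))// gt_max xe.
Qed.

Lemma pabs_dist x y : `|v x - v y| <= v (x - y).
Proof.
have sub a b : v a - v b <= v (a - b).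
  rewrite lerBlDr -{1}[a](subrK b) (le_trans (pabs_ultra _ _ _))// ge_max.
  by rewrite lerDl lerDr !pabs_ge0.
by rewrite ler_norml sub andbT lerNl opprB pabsB sub.
Qed.

Definition cauchy_seq : {pred nat -> F} := fun c => `[< forall e, 0 < e ->
  exists N, forall m n, (N <= m)%N -> (N <= n)%N -> v (c m - c n) < e >].

Lemma cauchy_seq_bound c : c \in cauchy_seq ->
  exists2 M, 0 < M & forall n, v (c n) <= M.
Proof.
move=> /asboolP /(_ _ ltr01)[N cN].
have ge0 (P : pred 'I_N.+1) : 0 <= \sum_(i < N.+1 | P i) v (c i).
  by apply: sumr_ge0 => i _; exact: pabs_ge0.
exists (1 + \sum_(i < N.+1) v (c i)) => [|n]; first by rewrite ltr_wpDr ?ge0.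
have le_sum k : (k < N.+1)%N -> v (c k) <= 1 + \sum_(i < N.+1) v (c i).
  move=> kN; rewrite (bigD1 (Ordinal kN)) //= addrCA lerDl.
  by rewrite addr_ge0 ?ge0.
have [nN|Nn] := ltnP n N.+1; first exact: le_sum.
rewrite -[c n](subrK (c N)) (le_trans (pabs_ultra _ _ _))//.
rewrite ge_max le_sum// andbT.
by rewrite (le_trans (ltW (cN _ _ (ltnW Nn) (leqnn N))))// lerDl ge0.
Qed.

Lemma cauchy_seq_subring : GRing.subring_closed cauchy_seq.
Proof.
split=> [|a b /asboolP ca /asboolP cb|a b ca cb]; apply/asboolP => e e0.
- by exists 0%N => m n _ _; rewrite subrr pabs0.
- have [N1 aN] := ca _ e0; have [N2 bN] := cb _ e0.
  exists (maxn N1 N2) => m n; rewrite !geq_max => /andP[m1 m2] /andP[n1 n2].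
  have -> : (a - b) m - (a - b) n = (a m - a n) + (b n - b m).
    rewrite -[LHS]/(a m - b m - (a n - b n)).
    by rewrite opprB addrACA [- b m - a n]addrC addrACA.
  by rewrite pabs_ltD ?aN ?bN.
- have [A A0 aA] := cauchy_seq_bound ca; have [B B0 bB] := cauchy_seq_bound cb.
  move/asboolP in ca; move/asboolP in cb.
  have [N1 aN] := ca _ (divr_gt0 e0 B0); have [N2 bN] := cb _ (divr_gt0 e0 A0).
  exists (maxn N1 N2) => m n; rewrite !geq_max => /andP[m1 m2] /andP[n1 n2].
  have -> : (a * b) m - (a * b) n = (a m - a n) * b m + a n * (b m - b n).
    by rewrite -[LHS]/(a m * b m - a n * b n) mulrBl mulrBr addrA subrK.
  apply: pabs_ltD; rewrite pabsM.
    rewrite (@le_lt_trans _ _ (v (a m - a n) * B)) ?ler_wpM2l ?pabs_ge0//.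
    by rewrite -ltr_pdivlMr// aN.
  rewrite (@le_lt_trans _ _ (A * v (b m - b n))) ?ler_wpM2r ?pabs_ge0//.
  by rewrite mulrC -ltr_pdivlMr// bN.
Qed.

HB.instance Definition _ :=
  GRing.isSubringClosed.Build (nat -> F) cauchy_seq cauchy_seq_subring.

Record cauchy := Cauchy {
  cauchy_val :> nat -> F;
  _ : cauchy_val \in cauchy_seq }.
HB.instance Definition _ := [isSub for cauchy_val].
HB.instance Definition _ := [Choice of cauchy by <:].
HB.instance Definition _ := [SubChoice_isSubComNzRing of cauchy by <:].

Definition null_seq : {pred cauchy} := fun c => `[< forall e, 0 < e ->
  exists N, forall n, (N <= n)%N -> v (c n) < e >].

Lemma null_seq_ideal : idealr_closed null_seq.
Proof.
split=> [||a x y].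
- by apply/asboolP => e e0; exists 0%N => n _; rewrite [X in v X]/= pabs0.
- apply/negP => /asboolP /(_ _ ltr01)[N /(_ _ (leqnn N))].
  by rewrite [X in v X]/= pabs1 ltxx.
move=> /asboolP nx /asboolP ny; apply/asboolP => e e0.
have [A A0 aA] := cauchy_seq_bound (valP a).
have [N1 xN] := nx _ (divr_gt0 e0 A0); have [N2 yN] := ny _ e0.
exists (maxn N1 N2) => n; rewrite geq_max => /andP[n1 n2].
apply: pabs_ltD; last exact: yN.
rewrite pabsM (@le_lt_trans _ _ (A * v (x n))) ?ler_wpM2r ?pabs_ge0//.
by rewrite mulrC -ltr_pdivlMr// xN.
Qed.

HB.instance Definition _ := isIdealr.Build cauchy null_seq null_seq_ideal.

Definition completion := {ideal_quot null_seq}.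
HB.instance Definition _ := GRing.ComNzRing.on completion.
HB.instance Definition _ := Quotient.on completion.

Lemma cauchy_cst (x : F) : (fun=> x) \in cauchy_seq.
Proof.
by apply/asboolP => e e0; exists 0%N => m n _ _; rewrite subrr pabs0.
Qed.

Definition cembed (x : F) : completion :=
  \pi_completion%qT (Cauchy (cauchy_cst x)).

Lemma cembed1 : cembed 1 = 1.
Proof.
rewrite -(rmorph1 (\pi_({ideal_quot null_seq})%qT)) /cembed.
by congr (\pi_completion%qT _); exact: val_inj.
Qed.

Lemma cembedM : {morph cembed : x y / x * y}.
Proof.
move=> x y; rewrite -(rmorphM (\pi_({ideal_quot null_seq})%qT)) /cembed.
by congr (\pi_completion%qT _); exact: val_inj.
Qed.

Definition cabs (x : completion) : R := lim ((v \o repr x) @ \oo).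

Lemma cauchy_cvg (c : cauchy) : cvgn (v \o c).
Proof.
apply/cauchy_cvgP/cauchy_exP => e e0.
have /asboolP /(_ _ e0)[N cN] := valP c.
exists (v (c N)); exists N => // n /= Nn.
by rewrite /ball/= (le_lt_trans (pabs_dist _ _))// cN//=.
Qed.

Lemma cabs_pi (c : cauchy) : cabs (\pi_completion%qT c) = lim ((v \o c) @ \oo).
Proof.
rewrite /cabs; set d := repr _.
have /asboolP null : d - c \in @null_seq.
  by rewrite Quotient.idealrBE reprK.
suff : (v \o d) \- (v \o c) @ \oo --> (0 : R).
  move=> /cvg_lim; rewrite limB; try exact: cauchy_cvg.
  by move=> /(_ (@Rhausdorff R))/eqP; rewrite subr_eq0 => /eqP.
apply/cvgrPdist_lt => e /null[N nN]; exists N => // n /= Nn.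
by rewrite sub0r normrN (le_lt_trans (pabs_dist _ _))// nN.
Qed.

Lemma cabs_cvg (c : cauchy) :
  (v \o c) @ \oo --> cabs (\pi_completion%qT c).
Proof. by rewrite cabs_pi; exact: cauchy_cvg. Qed.

Local Notation pi := (\pi_({ideal_quot null_seq})%qT).

Lemma cabs_ge0 x : 0 <= cabs x.
Proof.
apply: limr_ge; first exact: cauchy_cvg.
by apply: nearW => n /=; exact: pabs_ge0.
Qed.

Lemma cabs0 : cabs 0 = 0.
Proof.
rewrite -(rmorph0 pi) cabs_pi (_ : _ \o _ = cst 0).
  by apply: cvg_lim => //; exact: cvg_cst.
by apply/funext => n /=; rewrite [X in v X]/= pabs0.
Qed.

Lemma cabs1 : cabs 1 = 1.
Proof.
rewrite -(rmorph1 pi) cabs_pi (_ : _ \o _ = cst 1).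
  by apply: cvg_lim => //; exact: cvg_cst.
by apply/funext => n /=; rewrite [X in v X]/= pabs1.
Qed.

Lemma cabsN x : cabs (- x) = cabs x.
Proof.
rewrite -[x]reprK -(rmorphN pi) !cabs_pi.
set c := repr x; rewrite (_ : v \o (- c) = v \o c)//.
by apply/funext => n; exact: pabsN.
Qed.

Lemma cabsM x y : cabs (x * y) = cabs x * cabs y.
Proof.
rewrite -[x]reprK -[y]reprK -(rmorphM pi) !cabs_pi.
set c := repr x; set d := repr y; apply: cvg_lim => //.
rewrite (_ : _ \o _ = (v \o c) \* (v \o d)).
  by apply: cvgM; exact: cauchy_cvg.
by apply/funext => n /=; rewrite -pabsM.
Qed.

Lemma cabs_ultra x y : cabs (x + y) <= Num.max (cabs x) (cabs y).
Proof.
rewrite -[x]reprK -[y]reprK -(rmorphD pi).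
set c := repr x; set d := repr y.
apply/ler_addgt0Pl => e e0.
have near_le (b : cauchy) :
    \forall n \near \oo, v (b n) <= e + cabs (pi b).
  have /cvgrPdist_lt /(_ _ e0) := @cabs_cvg b.
  apply: filterS => n /= /ltW; rewrite distrC => /(le_trans (ler_norm _)).
  by rewrite lerBlDr.
rewrite [X in X <= _]cabs_pi; apply: limr_le; first exact: cauchy_cvg.
near=> n; rewrite /= (le_trans (pabs_ultra _ _ _))// ge_max.
apply/andP; split.
  rewrite (@le_trans _ _ (e + cabs (pi c)))// ?lerD2l ?le_max ?lexx//.
  by near: n.
rewrite (@le_trans _ _ (e + cabs (pi d)))// ?lerD2l ?le_max ?lexx ?orbT//.
by near: n.
Unshelve. all: by end_near. Qed.

(* The topology of the metric |x - y| on the completion. *)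
Definition completion_open (U : set completion) := forall x, U x ->
  exists2 e : R, 0 < e & forall y, cabs (y - x) < e -> U y.

Lemma completion_openT : completion_open setT.
Proof. by move=> x _; exists 1. Qed.

Lemma completion_openI : setI_closed completion_open.
Proof.
move=> A B oA oB x [Ax Bx]; have [e e0 eA] := oA _ Ax.
have [d d0 dB] := oB _ Bx; exists (Num.min e d) => [|y].
  by rewrite lt_min e0.
by rewrite lt_min => /andP[/eA Ay /dB By].
Qed.

Lemma completion_open_bigU (I : Type) (f : I -> set completion) :
  (forall i, completion_open (f i)) -> completion_open (\bigcup_i f i).
Proof.
move=> of_ x [i _ fx]; have [e e0 eP] := of_ i x fx.
by exists e => // y /eP fy; exists i.
Qed.

HB.instance Definition _ := isOpenTopological.Build completion
  completion_openT completion_openI completion_open_bigU.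

Definition local_ring : set completion := [set x | cabs x <= 1].

Lemma open_local_ring : open local_ring.
Proof.
move=> x /= x1; exists 1 => // y yx1.
rewrite -[y](subrK x) /local_ring/= (le_trans (cabs_ultra _ _))//.
by rewrite ge_max x1 ltW.
Qed.

End Completion.

Section FiniteAdele.
Variables (F : fieldExtType rat) (R : realType).
Local Notation place := (finite_place F R).

(* The restricted product of the completions with respect to the local rings. *)
Record finite_adele := FiniteAdele {
  fadele :> forall p : place, completion p;
  _ : finite_set [set p | ~ local_ring (fadele p)] }.

Implicit Types x y z : finite_adele.

Lemma fadeleP x : finite_set [set p | ~ local_ring (x p)].
Proof. by case: x. Qed.

Lemma fadele_eq x y : (forall p, x p = y p) -> x = y.
Proof.
case: x y => [x xP] [y yP] /= xy.
have {}xy : x = y by exact: functional_extensionality_dep.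
by rewrite -xy in yP *; congr FiniteAdele; exact: Prop_irrelevance.
Qed.

HB.instance Definition _ := gen_eqMixin finite_adele.
HB.instance Definition _ := gen_choiceMixin finite_adele.

Lemma fadele0_subproof :
  finite_set [set p : place | ~ local_ring (0 : completion p)].
Proof.
rewrite (_ : mkset _ = set0) //; apply/seteqP; split=> // p /=.
by rewrite /local_ring/= cabs0 ler01.
Qed.

Lemma fadele1_subproof :
  finite_set [set p : place | ~ local_ring (1 : completion p)].
Proof.
rewrite (_ : mkset _ = set0) //; apply/seteqP; split=> // p /=.
by rewrite /local_ring/= cabs1 lexx.
Qed.

Lemma fadeleN_subproof x : finite_set [set p | ~ local_ring (- x p)].
Proof.
by apply: sub_finite_set (fadeleP x) => p /=; rewrite /local_ring/= cabsN.
Qed.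

Lemma fadeleD_subproof x y : finite_set [set p | ~ local_ring (x p + y p)].
Proof.
apply: (@sub_finite_set _ _ ([set p | ~ local_ring (x p)] `|`
    [set p | ~ local_ring (y p)])); last first.
  by rewrite finite_setU; split; exact: fadeleP.
move=> p /= xy; apply: contrapT => /not_orP[/contrapT x1 /contrapT y1].
by apply: xy; rewrite /local_ring/= (le_trans (cabs_ultra _ _))// ge_max x1.
Qed.

Lemma fadeleM_subproof x y : finite_set [set p | ~ local_ring (x p * y p)].
Proof.
apply: (@sub_finite_set _ _ ([set p | ~ local_ring (x p)] `|`
    [set p | ~ local_ring (y p)])); last first.
  by rewrite finite_setU; split; exact: fadeleP.
move=> p /= xy; apply: contrapT => /not_orP[/contrapT x1 /contrapT y1].
by apply: xy; rewrite /local_ring/= cabsM mulr_ile1 ?cabs_ge0.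
Qed.

Let zero := FiniteAdele fadele0_subproof.
Let one := FiniteAdele fadele1_subproof.
Let opp x := FiniteAdele (fadeleN_subproof x).
Let add x y := FiniteAdele (fadeleD_subproof x y).
Let mul x y := FiniteAdele (fadeleM_subproof x y).

Let addA : associative add.
Proof. by move=> x y z; apply: fadele_eq => p /=; rewrite addrA. Qed.
Let addC : commutative add.
Proof. by move=> x y; apply: fadele_eq => p /=; rewrite addrC. Qed.
Let add0 : left_id zero add.
Proof. by move=> x; apply: fadele_eq => p /=; rewrite add0r. Qed.
Let addN : left_inverse zero opp add.
Proof. by move=> x; apply: fadele_eq => p /=; rewrite addNr. Qed.
HB.instance Definition _ :=
  GRing.isZmodule.Build finite_adele addA addC add0 addN.

Let mulA : associative mul.
Proof. by move=> x y z; apply: fadele_eq => p /=; rewrite mulrA. Qed.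
Let mulC : commutative mul.
Proof. by move=> x y; apply: fadele_eq => p /=; rewrite mulrC. Qed.
Let mul1 : left_id one mul.
Proof. by move=> x; apply: fadele_eq => p /=; rewrite mul1r. Qed.
Let mulD : left_distributive mul +%R.
Proof. by move=> x y z; apply: fadele_eq => p /=; rewrite mulrDl. Qed.
HB.instance Definition _ :=
  GRing.Zmodule_isComPzRing.Build finite_adele mulA mulC mul1 mulD.

(* The restricted product topology: the boxes U, with U p open and equal to   *)
(* the local ring at almost all places, are a base.                           *)
Definition finite_adele_open (W : set finite_adele) := forall x, W x ->
  exists U : forall p : place, set (completion p),
    [/\ forall p, open (U p),
        finite_set [set p | U p <> local_ring (v := p)],
        forall p, U p (x p) &
        forall y, (forall p, U p (y p)) -> W y].

Lemma finite_adele_openT : finite_adele_open setT.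
Proof.
move=> x _.
exists (fun p => if `[< local_ring (x p) >] then local_ring (v := p) else setT).
split=> // [p||p].
- by case: ifP => _; [exact: open_local_ring|exact: openT].
- by apply: sub_finite_set (fadeleP x) => p /=; case: asboolP.
- by case: asboolP.
Qed.

Lemma finite_adele_openI : setI_closed finite_adele_open.
Proof.
move=> A B oA oB x [Ax Bx].
have [U [oU fU Ux UA]] := oA _ Ax; have [V [oV fV Vx VB]] := oB _ Bx.
exists (fun p => U p `&` V p); split=> [p||p|y UVy].
- exact: openI.
- apply: (@sub_finite_set _ _ ([set p | U p <> local_ring (v := p)] `|`
    [set p | V p <> local_ring (v := p)])); last by rewrite finite_setU.
  move=> p /= UV; apply: contrapT => /not_orP[/contrapT Up /contrapT Vp].
  by apply: UV; rewrite Up Vp setIid.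
- by split.
- by split; [apply: UA|apply: VB] => p; have [] := UVy p.
Qed.

Lemma finite_adele_open_bigU (I : Type) (f : I -> set finite_adele) :
  (forall i, finite_adele_open (f i)) -> finite_adele_open (\bigcup_i f i).
Proof.
move=> of_ x [i _ fx]; have [U [oU fU Ux UP]] := of_ i x fx.
by exists U; split=> // y /UP fy; exists i.
Qed.

HB.instance Definition _ := isOpenTopological.Build finite_adele
  finite_adele_openT finite_adele_openI finite_adele_open_bigU.

End FiniteAdele.

Section Adele.
Variables (F : fieldExtType rat) (R : realType).

Definition infinite_adele := {ptws real_place F R -> R}.
HB.instance Definition _ := Topological.on infinite_adele.
HB.instance Definition _ :=
  GRing.ComPzRing.copy infinite_adele (real_place F R -> R).

Definition adele := (infinite_adele * finite_adele F R)%type.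
HB.instance Definition _ := Topological.on adele.
HB.instance Definition _ := GRing.ComPzRing.on adele.

(* a is the image of x under the diagonal embedding of F.                     *)
Definition diagonal (x : F) (a : adele) : Prop :=
  (forall s : real_place F R, a.1 s = s x) /\
  (forall p : finite_place F R, a.2 p = cembed p x).

(* An idele carries its inverse, and the idele group has the topology         *)
(* induced by t |-> (t, t^-1) from the square of the adele ring.              *)
Record idele := Idele {
  idele_val :> adele;
  idele_inv : adele;
  idele_mulV : idele_val * idele_inv = 1 }.

Lemma idele_eq (t u : idele) : t = u :> adele -> t = u.
Proof.
case: t u => [t t' tt'] [u u' uu'] /= tu; subst u.
have t'u' : t' = u' by rewrite -[t']mulr1 -uu' mulrA [t' * t]mulrC tt' mul1r.
by subst u'; congr Idele; exact: Prop_irrelevance.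
Qed.

HB.instance Definition _ := gen_eqMixin idele.
HB.instance Definition _ := gen_choiceMixin idele.

Definition idele1 : idele := Idele (mulr1 1).
HB.instance Definition _ := isPointed.Build idele idele1.

Lemma idelV_subproof (t : idele) : idele_inv t * idele_val t = 1.
Proof. by rewrite mulrC idele_mulV. Qed.
Definition ideleV (t : idele) : idele := Idele (idelV_subproof t).

Lemma ideleM_subproof (t u : idele) :
  (idele_val t * idele_val u) * (idele_inv t * idele_inv u) = 1.
Proof. by rewrite mulrACA !idele_mulV mulr1. Qed.
Definition ideleM (t u : idele) : idele := Idele (ideleM_subproof t u).

HB.instance Definition _ := Topological.copy idele
  (initial_topology (fun t : idele => ((t : adele), idele_inv t))).

Definition principal_idele (c : idele) : Prop :=
  exists2 x : F, x != 0 & diagonal x c.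

Lemma principal_idele1 : principal_idele idele1.
Proof.
exists 1; first exact: oner_neq0.
by split=> [s|p] /=; rewrite ?rmorph1 ?cembed1.
Qed.

Lemma principal_ideleM c d :
  principal_idele c -> principal_idele d -> principal_idele (ideleM c d).
Proof.
move=> [x x0 [xs xp]] [y y0 [ys yp]]; exists (x * y).
  by rewrite mulf_neq0.
split=> [s|p] /=; first by rewrite rmorphM -xs -ys.
by rewrite cembedM -xp -yp.
Qed.

Lemma principal_ideleV c : principal_idele c -> principal_idele (ideleV c).
Proof.
move=> [x x0 [xs xp]]; exists x^-1; first by rewrite invr_eq0.
have cV := idele_mulV c; split=> [s|p] /=.
  have cVs : s x * (idele_inv c).1 s = 1.
    by rewrite -xs -[LHS]/((idele_val c * idele_inv c).1 s) cV.
  rewrite fmorphV -[LHS]mul1r -(mulVf (x := s x)) ?fmorph_eq0//.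
  by rewrite -mulrA cVs mulr1.
have cVp : cembed p x * (idele_inv c).2 p = 1.
  by rewrite -xp -[LHS]/((idele_val c * idele_inv c).2 p) cV.
have xVx : cembed p x^-1 * cembed p x = 1 by rewrite -cembedM mulVf// cembed1.
by rewrite -[LHS]mul1r -xVx -mulrA cVp mulr1.
Qed.

Definition idele_class_rel (t u : idele) : bool :=
  `[< exists2 c, principal_idele c & u = ideleM c t >].

Lemma idele_class_rel_equiv : equiv_class_of idele_class_rel.
Proof.
have sym t u : idele_class_rel t u -> idele_class_rel u t.
  move=> /asboolP[c pc ->]; apply/asboolP; exists (ideleV c).
    exact: principal_ideleV.
  by apply: idele_eq; rewrite /= mulrA idelV_subproof mul1r.
split=> [t|t u|t u w].
- apply/asboolP; exists idele1; first exact: principal_idele1.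
  by apply: idele_eq; rewrite /= mul1r.
- by apply/idP/idP; exact: sym.
- move=> /asboolP[c pc ->] /asboolP[d pd ->]; apply/asboolP.
  exists (ideleM d c); first exact: principal_ideleM.
  by apply: idele_eq; rewrite /= mulrA.
Qed.
Canonical idele_class_equiv := EquivRelPack idele_class_rel_equiv.

Definition idele_class :=
  quotient_topology {eq_quot idele_class_equiv}%qT.
HB.instance Definition _ := Topological.on idele_class.
HB.instance Definition _ := Pointed.on idele_class.
HB.instance Definition _ := Quotient.on idele_class.

Definition idele_classM (a b : idele_class) : idele_class :=
  \pi_idele_class%qT (ideleM (repr a) (repr b)).

(* Both products have almost all factors equal to 1.                          *)
Definition idele_norm (t : idele) : R :=
  (\big[*%R/1]_(s \in [set: real_place F R]) `|(idele_val t).1 s|) *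
  (\big[*%R/1]_(p \in [set: finite_place F R]) cabs ((idele_val t).2 p)).

End Adele.

Section Haar.
Local Open Scope ereal_scope.

Definition borel (G : ptopologicalType) := g_sigma_algebraType (@open G).

Record is_haar (R : realType) (G : ptopologicalType) (mul : G -> G -> G)
    (mu : {measure set (borel G) -> \bar R}) : Prop := {
  haar_invariant : forall (a : G) (B : set (borel G)),
    measurable B -> mu (mul a @` B) = mu B;
  haar_compact : forall K : set G, compact K -> mu K < +oo;
  haar_open : forall U : set G, open U -> U !=set0 -> 0 < mu U;
  haar_outer_regular : forall B : set (borel G), measurable B ->
    mu B = ereal_inf [set mu U | U in [set U : set G | open U /\ B `<=` U]];
  haar_inner_regular : forall U : set G, open U ->
    mu U =
      ereal_sup [set mu K | K in [set K : set G | compact K /\ K `<=` U]] }.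

(* The quotient of mu by the counting measure of the discrete subgroup of     *)
(* principal ideles.                                                          *)
Definition is_quotient_measure (F : fieldExtType rat) (R : realType)
    (mu : {measure set (borel (idele F R)) -> \bar R})
    (nu : {measure set (borel (idele_class F R)) -> \bar R}) : Prop :=
  is_haar (@idele_classM F R) nu /\
  forall f : idele F R -> R,
    continuous f -> (forall t, (0 <= f t)%R) ->
    (exists2 K, compact K & forall t, ~ K t -> f t = 0%R) ->
    \int[mu]_(t in setT) (f t)%:E =
    \int[nu]_(q in setT)
      \esum_(t in [set t | \pi_(idele_class F R)%qT t = q]) (f t)%:E.

End Haar.

Section ComplexAnalysis.
Variable R : realType.
Local Notation C := (R[i]^o).

Definition cpow (a : R) (s : C) : C :=
  (expR (complex.Re s * ln a))%:C *
  (cos (complex.Im s * ln a) +i* sin (complex.Im s * ln a)).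

(* Equal to 0 when f is not integrable.                                       *)
Definition cintegral d (T : measurableType d) (mu : {measure set T -> \bar R})
    (f : T -> C) : C :=
  if `[< mu.-integrable setT (fun x => (complex.Re (f x))%:E) /\
         mu.-integrable setT (fun x => (complex.Im (f x))%:E) >]
  then (Rintegral mu setT (fun x => complex.Re (f x))) +i*
       (Rintegral mu setT (fun x => complex.Im (f x)))
  else 0.

Definition rsum (I : choiceType) (D : set I) (f : I -> R) : R :=
  fine (\esum_(i in D) (Num.max (f i) 0)%:E) -
  fine (\esum_(i in D) (Num.max (- f i) 0)%:E).

(* Equal to 0 when f is not absolutely summable.                              *)
Definition csum (I : choiceType) (D : set I) (f : I -> C) : C :=
  if `[< summable D (fun i => (complex.Re (f i))%:E) /\
         summable D (fun i => (complex.Im (f i))%:E) >]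
  then rsum D (fun i => complex.Re (f i)) +i* rsum D (fun i => complex.Im (f i))
  else 0.

(* A Laurent expansion with finite principal part on a punctured              *)
(* neighbourhood; the value at the centre is irrelevant.                      *)
Definition meromorphic_at (f : C -> C) (s0 : C) : Prop :=
  exists (n : nat) (a : nat -> C), \forall s \near s0^',
    series (fun k => a k * (s - s0) ^+ k : C) @ \oo -->
      ((s - s0) ^+ n * f s : C).

Definition meromorphic (f : C -> C) : Prop := forall s0, meromorphic_at f s0.

(* Equality as meromorphic functions, that is, away from a discrete set.      *)
Definition meromorphic_eq (f g : C -> C) : Prop :=
  forall s0 : C, \forall s \near s0^', f s = g s.

(* Unique up to meromorphic_eq by the identity theorem; the constant 0 if f   *)
(* has no meromorphic continuation from the half-plane c < Re s.              *)
Definition meromorphic_continuation (c : R) (f : C -> C) : C -> C :=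
  xget (fun=> 0)
    [set M | meromorphic M /\ forall s, c < complex.Re s -> M s = f s].

End ComplexAnalysis.

Section Eisenstein.
Variables (F : fieldExtType rat) (R : realType).
Local Notation C := (R[i]^o).

Record is_unitary_hecke (w : idele F R -> C) : Prop := {
  hecke_continuous : continuous w;
  heckeM : forall t u, w (ideleM t u) = w t * w u;
  hecke_principal : forall c, principal_idele c -> w c = 1;
  hecke_unitary : forall t, `|w t| = 1 }.

(* The Schwartz space of the plane over the infinite adeles, a real vector    *)
(* space with coordinates indexed by 'I_2 * real_place F R.                   *)
Definition coord_index := ('I_2 * real_place F R)%type.

Definition coord (c : coord_index) (x : 'cV[infinite_adele F R]_2) : R :=
  x c.1 ord0 c.2.

Definition along (c : coord_index) (h : R) : 'cV[infinite_adele F R]_2 :=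
  \col_i (fun s => if (i, s) == c then h else 0).

(* D l is the iterated partial derivative of f along the coordinates in l.    *)
Definition is_schwartz (f : 'cV[infinite_adele F R]_2 -> C) : Prop :=
  exists D : seq coord_index -> 'cV[infinite_adele F R]_2 -> C,
    [/\ D [::] = f,
        forall l c x,
          is_derive (0 : R) 1 (fun h => complex.Re (D l (x + along c h)))
            (complex.Re (D (c :: l) x)) /\
          is_derive (0 : R) 1 (fun h => complex.Im (D l (x + along c h)))
            (complex.Im (D (c :: l) x)) &
        forall (m l : seq coord_index), exists M : R, forall x,
          `|(\prod_(c <- m) coord c x)%:C * D l x| <= M%:C].

Definition is_bruhat (h : 'cV[finite_adele F R]_2 -> C) : Prop :=
  (forall x, \forall y \near x, h y = h x) /\
  (exists2 K, compact K & forall x, ~ K x -> h x = 0).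

Definition is_schwartz_bruhat (phi : 'cV[adele F R]_2 -> C) : Prop :=
  exists (n : nat) (f : 'I_n -> 'cV[infinite_adele F R]_2 -> C)
    (h : 'I_n -> 'cV[finite_adele F R]_2 -> C),
    [/\ forall k, is_schwartz (f k), forall k, is_bruhat (h k) &
        forall x, phi x = \sum_(k < n) f k (map_mx fst x) * h k (map_mx snd x)].

(* An element of GL_2 of the adele ring, with its inverse.                    *)
Record gl2 := Gl2 {
  gl2_val :> 'M[adele F R]_2;
  gl2_inv : 'M[adele F R]_2;
  gl2_mulV : gl2_val *m gl2_inv = 1%:M;
  gl2_Vmul : gl2_inv *m gl2_val = 1%:M }.

Lemma gl2M_mulV (g h : gl2) :
  (gl2_val g *m gl2_val h) *m (gl2_inv h *m gl2_inv g) = 1%:M.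
Proof. by rewrite mulmxA -(mulmxA (gl2_val g)) gl2_mulV mulmx1 gl2_mulV. Qed.
Lemma gl2M_Vmul (g h : gl2) :
  (gl2_inv h *m gl2_inv g) *m (gl2_val g *m gl2_val h) = 1%:M.
Proof. by rewrite mulmxA -(mulmxA (gl2_inv h)) gl2_Vmul mulmx1 gl2_Vmul. Qed.
Definition gl2M (g h : gl2) : gl2 := Gl2 (gl2M_mulV g h) (gl2M_Vmul g h).

Lemma gl2_scalar_mulV (t : idele F R) :
  (idele_val t)%:M *m (idele_inv t)%:M = 1%:M :> 'M[adele F R]_2.
Proof. by rewrite -scalar_mxM idele_mulV. Qed.
Lemma gl2_scalar_Vmul (t : idele F R) :
  (idele_inv t)%:M *m (idele_val t)%:M = 1%:M :> 'M[adele F R]_2.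
Proof. by rewrite -scalar_mxM idelV_subproof. Qed.
Definition gl2_scalar (t : idele F R) : gl2 :=
  Gl2 (gl2_scalar_mulV t) (gl2_scalar_Vmul t).

Lemma gl2_det_subproof (g : gl2) : \det (gl2_val g) * \det (gl2_inv g) = 1.
Proof. by rewrite -det_mulmx gl2_mulV det1. Qed.
Definition gl2_det (g : gl2) : idele F R := Idele (gl2_det_subproof g).

(* The image in the adelic plane of the nonzero vectors with entries in F.    *)
Definition rational_vectors : set 'cV[adele F R]_2 := [set x |
  exists2 u : 'cV[F]_2, u != 0 & forall i, diagonal (u i ord0) (x i ord0)].

Definition theta (phi : 'cV[adele F R]_2 -> C) (g : gl2) : C :=
  csum rational_vectors (fun x => phi (gl2_inv g *m x)).

(* Only functions invariant under the principal ideles descend to the         *)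
(* quotient; the value for any other function is 0.                           *)
Definition class_integral
    (nu : {measure set (borel (idele_class F R)) -> \bar R})
    (f : idele F R -> C) : C :=
  if `[< forall c t, principal_idele c -> f (ideleM c t) = f t >]
  then cintegral nu (fun q => f (repr (q : idele_class F R))) else 0.

Definition eisenstein_integral
    (nu : {measure set (borel (idele_class F R)) -> \bar R})
    (w : idele F R -> C) (phi : 'cV[adele F R]_2 -> C) (g : gl2) (s : C) : C :=
  cpow (idele_norm (gl2_det g)) (- s) *
  class_integral nu (fun t => w t * cpow (idele_norm t) (2 * s) *
    theta phi (gl2M (gl2_scalar (ideleV t)) g)).

Definition eisenstein
    (nu : {measure set (borel (idele_class F R)) -> \bar R})
    (w : idele F R -> C) (phi : 'cV[adele F R]_2 -> C) (g : gl2) : C -> C :=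
  meromorphic_continuation 1 (eisenstein_integral nu w phi g).

End Eisenstein.

(* Main.v *)
Require Import Defs.
From HB Require Import structures.
From mathcomp Require Import all_boot all_order all_algebra all_field.
From mathcomp Require Import complex.
From mathcomp Require Import all_classical all_reals all_analysis.
From mathcomp Require Import measurable_realfun ring lra.

Set Implicit Arguments.
Unset Strict Implicit.
Unset Printing Implicit Defensive.

Import Order.TTheory GRing.Theory Num.Theory.
Import numFieldNormedType.Exports.

Local Open Scope classical_set_scope.
Local Open Scope complex_scope.
Local Open Scope ring_scope.

(* Substituting t = z u in the integral over the idele classes turns          *)
(* |z^2 det g|^-s w(t) |t|^2s Theta(t^-1 z g) into w(z) times the integrand   *)
(* for g, so invariance of the quotient measure gives the identity wherever   *)
(* the integral defines E. It extends to the plane by the identity theorem:   *)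
(* near each point a meromorphic function vanishes or has no zero, which      *)
(* yields a partition into two open sets.                                     *)

(** * Power series *)

(** Replacing [g] by [z g] affects the integral in two ways. Since [Theta(t^-1 z g)] depends only on
    [z^-1 t] and [g], and both [w] and the norm are multiplicative, the new integrand at [t] is
    [w(z) |z|^(2s)] times the old one at [z^-1 t] ([eisenstein_integrand_scalarM]). Invariance of
    the Haar measure on idele classes then removes the translation ([class_integral_translate]). The
    determinant becomes [z^2 det g], so the outer factor gains [|z|^(-2s)], which cancels [|z|^(2s)]
    and leaves [w(z)] ([eisenstein_integral_scalarM]). As [w(z)] is a nonzero constant in [s], it
    passes through analytic continuation ([meromorphic_continuationZ]). A continuation is an
    arbitrary choice among functions agreeing on a half-plane, so this rests on the identity theorem
    [meromorphic_eq0]. The measure-theoretic step requires translations of idele classes to be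
    Borel, hence the continuity lemmas; the cancellation requires the norm to be multiplicative and
    positive, hence the finiteness lemmas on places. *)

Section PowerSeries.
Variable K : numFieldType.
Implicit Types (a : nat -> K^o) (f g : K^o -> K^o).

Lemma geometric_sum_le2 (q : K) n :
  0 <= q -> q <= 2^-1 -> \sum_(k < n) q ^+ k <= 2.
Proof.
move=> q0 q2; elim: n => [|n IHn]; first by rewrite big_ord0.
rewrite big_ord_recl expr0 -[leRHS]/(1 + 1) lerD2l.
under eq_bigr do rewrite /= /bump add1n exprS.
rewrite -mulr_sumr (le_trans (ler_wpM2l q0 IHn))//.
by rewrite -ler_pdivlMr// mul1r.
Qed.

(** The terms of a convergent series tend to 0 and so are bounded. This takes the place of Cauchy's
    estimates. *)
Lemma cvg_series_coef_bound a (r : K) : 0 < r ->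
  cvgn (series (fun k => a k * r ^+ k : K^o)) ->
  exists2 M, 0 < M & forall k, `|a k| * r ^+ k <= M.
Proof.
move=> r0 /cvg_series_cvg_0 => cv.
have : cvgn (fun k => a k * r ^+ k : K^o) by apply/cvg_ex; exists 0.
move=> /cvg_seq_bounded/pinfty_ex_gt0[M M0 aM]; exists M => // k.
by rewrite -(ger0_norm (exprn_ge0 k (ltW r0))) -normrM aM.
Qed.

(** If some coefficient is nonzero, let [a m] be the first such. For small [h] the later terms sum
    to at most half of [a m * h ^+ m] in norm, so the sum cannot vanish. *)
Lemma power_series_zero_dichotomy a f :
  (\forall h \near (0 : K^o)^',
    series (fun k => a k * h ^+ k : K^o) @ \oo --> f h) ->
  (\forall h \near (0 : K^o)^', f h = 0) \/
  (\forall h \near (0 : K^o)^', f h != 0).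
Proof.
move=> af; have [a0|] := pselect (forall k, a k = 0).
  left; apply: filterS af => h.
  rewrite (_ : series (fun k => a k * h ^+ k : K^o) = fun=> 0).
    move=> cv; apply: (cvg_unique (@norm_hausdorff _ _) cv).
    exact: cvg_cst.
  by apply/funext => n; rewrite /series/= big1// => k _; rewrite a0 mul0r.
move=> /existsNP[n0 /eqP an0]; right.
case: (@ex_minnP (fun m => a m != 0)); first by exists n0.
move=> m am min_m {n0 an0}.
have {min_m} a_lt_m k : (k < m)%N -> a k = 0.
  move=> km; apply/eqP; apply: contraTT km => /min_m; by rewrite -leqNgt.
have [r /= r0 rf] := af.
have r20 : 0 < r / 2 by rewrite divr_gt0.
set p := r / 2 in r20.
have pr : p < r by rewrite /p ltr_pdivrMr// mulr_natr mulr2n ltrDl.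
have cf h : 0 < `|h| -> `|h| < r ->
    series (fun k => a k * h ^+ k : K^o) @ \oo --> f h.
  move=> h0 hr; apply: rf => /=; last by rewrite -normr_gt0.
  by rewrite sub0r normrN.
have [M M0 aM] : exists2 M, 0 < M & forall k, `|a k| * p ^+ k <= M.
  apply: cvg_series_coef_bound => //; apply/cvg_ex; exists (f p).
  by apply: cf; rewrite gtr0_norm.
(* With [q = |h| / p], the bound [q < 1/2] keeps the geometric series below 2, and
   [4 M q < |a m| p^m] makes the resulting tail bound [2 M q^(m+1)] at most half of
   [|a m| (q p)^m]. *)
set e := Num.min (2^-1) (`|a m| * p ^+ m / (4 * M)).
have am0 : 0 < `|a m| by rewrite normr_gt0.
have ap0 : 0 < `|a m| * p ^+ m / (4 * M).
  by rewrite divr_gt0 ?mulr_gt0 ?exprn_gt0.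
have e0 : 0 < e.
  rewrite /e comparable_lt_min ?invr_gt0 ?ltr0n//.
  by rewrite real_comparable// gtr0_real// invr_gt0.
have ce : 2^-1 >=< `|a m| * p ^+ m / (4 * M).
  by rewrite real_comparable// gtr0_real// invr_gt0.
exists (p * e) => /= [|h]; first by rewrite mulr_gt0.
rewrite /ball_/= sub0r normrN => hpe h0.
have {}h0 : 0 < `|h| by rewrite normr_gt0.
set q := `|h| / p.
have q0 : 0 <= q by rewrite divr_ge0 ?ltW.
have qe : q < e by rewrite ltr_pdivrMr// mulrC.
have hE : `|h| = q * p by rewrite /q divfK// gt_eqF.
clearbody q.
have q2 : q < 2^-1 by move: qe; rewrite /e comparable_lt_min// => /andP[].
have qM : q * (4 * M) < `|a m| * p ^+ m.
  move: qe; rewrite /e comparable_lt_min// => /andP[_].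
  by rewrite ltr_pdivlMr// mulr_gt0.
have hr : `|h| < r.
  rewrite (lt_trans _ pr)// hE -ltr_pdivlMr// divff ?gt_eqF//.
  by rewrite (lt_trans q2)// invf_lt1// ltr1n.
have tail n : `|\sum_(j < n) a (m.+1 + j)%N * h ^+ (m.+1 + j)| <=
    `|a m * h ^+ m| / 2.
  apply: (@le_trans _ _ (\sum_(j < n) M * q ^+ m.+1 * q ^+ j)).
    rewrite (le_trans (ler_norm_sum _ _ _))//; apply: ler_sum => j _.
    rewrite normrM normrX hE -mulrA -exprD exprMn mulrCA mulrC.
    by rewrite ler_wpM2r// exprn_ge0.
  rewrite -mulr_sumr (@le_trans _ _ (M * q ^+ m.+1 * 2))//.
    apply: ler_wpM2l; first by rewrite mulr_ge0 ?exprn_ge0// ltW.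
    by apply: geometric_sum_le2 => //; exact: ltW.
  rewrite normrM normrX hE exprMn.
  have -> : M * q ^+ m.+1 * 2 = q ^+ m / 2 * (q * (4 * M)).
    by rewrite exprSr; field.
  have -> : `|a m| * (q ^+ m * p ^+ m) / 2 = q ^+ m / 2 * (`|a m| * p ^+ m).
    by field.
  by rewrite ler_wpM2l ?(ltW qM)// divr_ge0// exprn_ge0.
(* If the limit were 0, a late partial sum [c + b], with leading term [c] and tail [b], would be
   smaller than [|c| / 2]; with [|b| <= |c| / 2] this contradicts the triangle inequality. *)
apply/eqP => fh0; have := cf _ h0 hr; rewrite fh0 => /cvgrPdist_lt.
have ah0 : 0 < `|a m * h ^+ m| by rewrite normrM normrX mulr_gt0// exprn_gt0.
move=> /(_ (`|a m * h ^+ m| / 2)); rewrite divr_gt0// => /(_ isT)[N _ HN].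
have := HN (m.+1 + N)%N; rewrite /= leq_addl => /(_ isT).
rewrite sub0r normrN /series/= big_mkord big_split_ord/= big_ord_recr/=.
rewrite big1 ?add0r; last by move=> i _; rewrite a_lt_m ?mul0r.
move=> /lt_le_trans lt; have := tail N; apply/negP.
rewrite -real_ltNge ?normr_real ?realM ?realV ?realn ?normr_real//.
set b := \sum_(_ < N) _ in lt *; set c := a m * h ^+ m in lt *.
have : `|c| <= `|c + b| + `|b|.
  by rewrite -{1}(addrK b c) ler_normB.
rewrite {1}[`|c|](splitr) => cb.
have := lt _ (lexx _); rewrite -(ltrD2r (`|b|)) => /(le_lt_trans cb).
by rewrite ltrD2l.
Qed.

End PowerSeries.

(** * Meromorphic functions *)

Section Meromorphic.
Variable R : realType.
Local Notation C := (R[i]^o).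
Implicit Types (f g : C -> C) (c s t : C).

Lemma near_dnbhs_shift (P : C -> Prop) (s0 : C) :
  (\forall s \near s0^', P s) <-> (\forall h \near (0 : C)^', P (s0 + h)).
Proof.
split=> -[e /= e0 eP]; exists e => //= s; rewrite /ball_/=.
  rewrite sub0r normrN => se s0'; apply: eP => /=.
    by rewrite opprD addNKr normrN.
  by rewrite addrC -subr_eq0 addrK.
move=> se ss0; rewrite -(subrKC s0 s); apply: eP => /=.
  by rewrite sub0r opprB.
by rewrite subr_eq0.
Qed.

(** Multiplying by [h ^+ n] shifts the coefficients. This brings two Laurent expansions with
    different pole orders to a common order, so that they can be added. *)
Lemma cvg_series_shift (a : nat -> C) (h l : C) n :
  series (fun k => a k * h ^+ k : C) @ \oo --> l ->
  series (fun k => (if (k < n)%N then 0 else a (k - n)%N) * h ^+ k : C) @ \oo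
    --> (h ^+ n * l : C).
Proof.
move=> cv; rewrite -(cvg_shiftn n).
rewrite (_ : [sequence _]_n = h ^+ n \*: series (fun k => a k * h ^+ k : C)).
  exact: cvgZr.
apply/funext => N; rewrite /series/= !big_mkord addnC big_split_ord/=.
rewrite big1 ?add0r => [|i _]; last by rewrite ltn_ord mul0r.
rewrite scaler_sumr; apply: eq_bigr => i _.
by rewrite ltnNge leq_addr/= addKn exprD mulrCA.
Qed.

Lemma meromorphic_atZ c f (s0 : C) :
  meromorphic_at f s0 -> meromorphic_at (fun s => c * f s) s0.
Proof.
move=> [n [a af]]; exists n, (fun k => c * a k); apply: filterS af => s cv.
rewrite (_ : series _ = c \*: series (fun k => a k * (s - s0) ^+ k : C)).
  by rewrite mulrCA; exact: cvgZr.
by apply/funext => N; rewrite /series/= scaler_sumr; apply: eq_bigr => i _;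
  rewrite -mulrA.
Qed.

Lemma meromorphic_atD f g (s0 : C) : meromorphic_at f s0 -> meromorphic_at g s0 ->
  meromorphic_at (fun s => f s + g s) s0.
Proof.
move=> [n [a af]] [m [b bg]]; exists (m + n)%N.
exists (fun k => (if (k < m)%N then 0 else a (k - m)%N) +
                 (if (k < n)%N then 0 else b (k - n)%N)).
apply: filterS2 af bg => s.
move=> /(cvg_series_shift (n := m)) cf /(cvg_series_shift (n := n)) cg.
rewrite [X in _ --> X](_ : _ = (s - s0) ^+ m * ((s - s0) ^+ n * f s) +
    (s - s0) ^+ n * ((s - s0) ^+ m * g s)); last first.
  by rewrite mulrDr {2}[(m + n)%N]addnC !exprD -!mulrA.
apply: cvg_trans (cvgD cf cg); apply: near_eq_cvg; apply: nearW => N.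
rewrite fctE /series/= -big_split.
by apply: eq_bigr => i _ /=; rewrite -mulrDl.
Qed.

Lemma meromorphic_at_zero_dichotomy f (s0 : C) : meromorphic_at f s0 ->
  (\forall s \near s0^', f s = 0) \/ (\forall s \near s0^', f s != 0).
Proof.
move=> [n [a /near_dnbhs_shift af]].
have neq0 : \forall h \near (0 : C)^', h != 0 by exact: nbhs_dnbhs_neq.
have {}af : \forall h \near (0 : C)^', series (fun k => a k * h ^+ k : C) @ \oo
    --> (h ^+ n * f (s0 + h) : C).
  by apply: filterS af => h; rewrite addrC addKr.
case: (power_series_zero_dichotomy af) => fP; [left|right];
  apply/near_dnbhs_shift; apply: filterS2 neq0 fP => h h0.
  by move=> /eqP; rewrite mulf_eq0 expf_eq0 (negPf h0) andbF => /eqP.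
by rewrite mulf_eq0 negb_or => /andP[].
Qed.

(** Around a point [t] other than [s0], a small enough neighbourhood avoids [s0]. Hence each
    alternative of the zero dichotomy is an open condition on the centre. *)
Lemma near_dnbhs_near (P : C -> Prop) (s0 : C) : (\forall s \near s0^', P s) ->
  \forall t \near s0, \forall s \near t^', P s.
Proof.
move=> sP; have /nbhs_interior : nbhs s0 (fun s => s != s0 -> P s) by [].
apply: filterS => t /= tP.
have [->|ts0] := eqVneq t s0; first exact: sP.
have : \forall s \near t, s != s0.
  exists `|t - s0| => /= [|s]; first by rewrite normr_gt0 subr_eq0.
  by apply: contraTneq => ->; rewrite /ball_/= ltxx.
move=> /nbhs_dnbhs; apply: filterS2 (nbhs_dnbhs tP) => s; exact.
Qed.

(** The horizontal line through [s0] suffices: it reaches the half-plane, and it is a copy of the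
    connected real line. The dichotomy splits it into two disjoint open sets, and the one where [f]
    vanishes nearby is nonempty. *)
Lemma meromorphic_eq0 f (c : R) : meromorphic f ->
  (forall s, c < complex.Re s -> f s = 0) ->
  forall s0, \forall s \near s0^', f s = 0.
Proof.
move=> mf f0 s0; pose l (t : R) : C := s0 + t%:C.
have lc : continuous l.
  move=> t; apply/cvgrPdist_lt => -[e e'].
  rewrite ltcE/= => /andP[/eqP -> e0]; near=> u.
  rewrite opprD addrACA subrr add0r -rmorphB normc_def/= expr0n addr0 sqrtr_sqr.
  rewrite ltcR; near: u.
  by move/cvgrPdist_lt: (@cvg_id _ (nbhs t)) => /(_ e e0).
pose P b (s : C) := \forall t \near s^', (f t == 0) = b.
pose E b := l @^-1` [set s | P b s].
have oE b : open (E b).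
  apply: open_comp => [t _|]; first exact: lc.
  rewrite openE => s Ps.
  exact: near_dnbhs_near Ps.
have EC : ~` E false = E true.
  apply/seteqP; split=> t.
    case: (meromorphic_at_zero_dichotomy (mf (l t))) => fP + //.
      by move=> _; apply: filterS fP => s /eqP.
    by case; apply: filterS fP => s /negPf.
  (* Punctured neighbourhoods are nonempty, so the two alternatives exclude each other. *)
  move=> t1 t0; have [s []] : exists s, (f s == 0) = false /\ (f s == 0) = true.
    apply: (filter_ex (F := (l t)^')).
    by apply: filterS2 t0 t1 => s.
  by move=> ->.
suff : E true = setT.
  have s0E : l 0 = s0 by rewrite /l addr0.
  rewrite -{}s0E => /seteqP[_ /(_ 0 I)]; apply: filterS => s; by move=> /eqP.
apply: (connected_intervalP setT).2 => //.
(* This parameter gives a point of real part [c + 1], whose unit ball lies in the half-plane where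
   [f] vanishes. *)
- exists (c - complex.Re s0 + 1) => /=.
  apply/nbhs_dnbhs; near=> s; apply/eqP/f0; near: s.
  set t0 := l _; exists 1 => //= s; rewrite /ball_/= => st.
  have := le_lt_trans (normc_ge_Re _) st; rewrite ltcR => /ltr_normlW.
  by rewrite /t0 /l /=; case: (s0) (s) => [? ?] [? ?] /=; lra.
- by exists (E true); rewrite ?setTI.
- exists (E true); rewrite ?setTI// -EC; apply: open_closedC; exact: oE.
Unshelve. all: by end_near. Qed.

End Meromorphic.

(** * Constant factors and meromorphic continuation *)

Section Continuation.
Variable R : realType.
Local Notation C := (R[i]^o).

Lemma meromorphic_continuationP (c : R) (f M : C -> C) :
  meromorphic M -> (forall s, c < complex.Re s -> M s = f s) ->
  meromorphic (meromorphic_continuation c f) /\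
  forall s, c < complex.Re s -> meromorphic_continuation c f s = f s.
Proof.
by move=> mM Mf; rewrite /meromorphic_continuation; case: xgetP => [g ->|/(_ M)[]].
Qed.

(** Multiplication by [a] and by [a^-1] exchanges continuations of [g] and of [f], so either both
    exist or both default to 0. When they exist, the difference of the two sides vanishes on the
    half-plane and the identity theorem applies. *)
Lemma meromorphic_continuationZ (c : R) (a : C) (f g : C -> C) : a != 0 ->
  (forall s, c < complex.Re s -> f s = a * g s) ->
  meromorphic_eq (meromorphic_continuation c f)
    (fun s => a * meromorphic_continuation c g s).
Proof.
move=> a0 fg.
have [[M [mM Mg]]|noM] := pselect (exists M : C -> C, meromorphic M /\
    forall s, c < complex.Re s -> M s = g s).
  have [mcg cgE] := meromorphic_continuationP mM Mg.
  have maM : meromorphic (fun s => a * M s) by move=> s; exact: meromorphic_atZ.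
  have aMf s : c < complex.Re s -> a * M s = f s by move=> cs; rewrite fg ?Mg.
  have [mcf cfE] := meromorphic_continuationP maM aMf.
  move=> s0.
  pose D s := meromorphic_continuation c f s +
    (- a) * meromorphic_continuation c g s.
  have mD : meromorphic D.
    by move=> s; apply: meromorphic_atD => //; exact: meromorphic_atZ.
  have D0 s : c < complex.Re s -> D s = 0.
    by move=> cs; rewrite /D cfE// cgE// fg// mulNr subrr.
  apply: filterS (meromorphic_eq0 mD D0 s0) => s.
  by rewrite /D mulNr => /eqP; rewrite subr_eq0 => /eqP.
rewrite [X in _ X](_ : _ = fun=> 0); last first.
  apply/funext => s; rewrite /meromorphic_continuation xgetPN ?mulr0// => M HM.
  by apply: noM; exists M.
rewrite /meromorphic_continuation xgetPN => [|M [mM Mf]].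
  by move=> s0; exact: nearW.
apply: noM; exists (fun s => a^-1 * M s); split=> [s|s cs].
  exact: meromorphic_atZ.
by rewrite Mf// fg// mulKf.
Qed.

End Continuation.

(** * Continuity of multiplication *)

Lemma continuous_ptws (X : topologicalType) (I : choiceType)
    (T : topologicalType) (f : X -> {ptws I -> T}) :
  (forall i, continuous (fun x => f x i)) -> continuous f.
Proof.
move=> cf x; apply/cvg_sup => i.
exact: (@continuous_comp_initial (I -> T) X T (fun g => g i) f (cf i) x).
Qed.

Lemma ptws_mul_continuous (R : realType) (I : choiceType) (a : I -> R) :
  continuous (fun x : {ptws I -> R} => (fun i => a i * x i) : {ptws I -> R}).
Proof.
apply: (@continuous_ptws {ptws I -> R} I R (fun x i => a i * x i)) => i x.
have xi := @proj_continuous I (fun=> R) i x.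
have axi := @continuous_comp {ptws I -> R} R R (proj i) (fun r => a i * r) x xi
  (@mulrl_continuous R (a i) (proj i x)).
exact axi.
Qed.

Lemma continuous_pair (X Y Z : topologicalType) (f : X -> Y) (g : X -> Z) :
  continuous f -> continuous g -> continuous (fun x => (f x, g x)).
Proof. by move=> cf cg x; apply: cvg_pair; [exact: cf|exact: cg]. Qed.

Lemma continuous_map_pair (X Y Z T : topologicalType) (f : X -> Y) (g : Z -> T) :
  continuous f -> continuous g -> continuous (fun x => (f x.1, g x.2)).
Proof.
move=> cf cg; apply: continuous_pair => x; apply: continuous_comp;
  by [exact: cvg_fst|exact: cvg_snd|exact: cf|exact: cg].
Qed.

(** * Translations of adeles, ideles and idele classes *)

Section Topology.
Variables (F : fieldExtType rat) (R : realType).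

(** At almost every place both [a] and its inverse are integral, so multiplication by [a] maps the
    local ring onto itself. The preimage of a basic box is therefore again a basic box. *)
Lemma finite_adele_mul_continuous (a b : finite_adele F R) : a * b = 1 ->
  continuous (fun x : finite_adele F R => a * x).
Proof.
move=> ab1; apply/continuousP => W oW.
rewrite -[open _]/(finite_adele_open _) => x /= Wax.
have [U [oU fU Uax UW]] := oW _ Wax.
exists (fun p => [set y | U p (a p * y)]); split=> [p||//|y Uy].
- rewrite -[open _]/(completion_open _) => y /= Uy; have [e e0 eU] := oU p _ Uy.
  (* Adding 1 keeps the denominator positive without inspecting [a p]. *)
  exists (e / (cabs (a p) + 1)) => [|u ue].
    by rewrite divr_gt0// ltr_wpDl// cabs_ge0.
  apply: eU; rewrite -mulrBr cabsM.
  have ap0 : 0 < cabs (a p) + 1 by rewrite ltr_wpDl// cabs_ge0.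
  rewrite (@le_lt_trans _ _ ((cabs (a p) + 1) * cabs (u - y)))//.
    by rewrite ler_wpM2r ?cabs_ge0// lerDl.
  by rewrite mulrC -ltr_pdivlMr.
- apply: (@sub_finite_set _ _ ([set p | U p <> local_ring (v := p)] `|`
    ([set p | ~ local_ring (a p)] `|` [set p | ~ local_ring (b p)]))); last first.
    by rewrite !finite_setU; split=> //; split; exact: fadeleP.
  move=> p /= Up; apply: contrapT => /not_orP[/contrapT UpE].
  move=> /not_orP[/contrapT a1 /contrapT b1]; apply: Up; rewrite UpE.
  have abp : a p * b p = 1 by rewrite -[LHS]/((a * b) p) ab1.
  apply/seteqP; split=> y /=; rewrite /local_ring/= => y1.
    rewrite -[y]mul1r -abp [a p * b p]mulrC -mulrA cabsM mulr_ile1 ?cabs_ge0//.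
  by rewrite cabsM mulr_ile1 ?cabs_ge0.
- exact: UW.
Qed.

Lemma infinite_adele_mul_continuous (a : infinite_adele F R) :
  continuous (fun x : infinite_adele F R => a * x).
Proof. exact: ptws_mul_continuous. Qed.

Lemma adele_mul_continuous (a b : adele F R) : a * b = 1 ->
  continuous (fun x : adele F R => a * x).
Proof.
move=> ab1; have ab2 : a.2 * b.2 = 1 by rewrite -[LHS]/((a * b).2) ab1.
exact (continuous_map_pair (@infinite_adele_mul_continuous a.1)
  (finite_adele_mul_continuous ab2)).
Qed.

(** In the topology induced by [u |-> (u, u^-1)], this amounts to continuity of multiplication by
    [t] on the first component and by its inverse on the second. *)
Lemma ideleM_continuous (t : idele F R) : continuous (ideleM t).
Proof.
pose i (u : idele F R) := ((u : adele F R), idele_inv u).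
have ic : continuous i := @initial_continuous _ _ i.
have mc := continuous_map_pair (adele_mul_continuous (idele_mulV t))
  (adele_mul_continuous (idelV_subproof t)).
have imc u := continuous_comp (ic u) (mc (i u)).
exact (@continuous_comp_initial _ _ _ i (ideleM t) imc).
Qed.

Lemma idele_class_eqP (t u : idele F R) :
  reflect (exists2 c, principal_idele c & u = ideleM c t)
    (\pi_(idele_class F R)%qT t == \pi_(idele_class F R)%qT u).
Proof.
apply: (iffP idP) => [/eqP/eqquotP/asboolP//|tu].
by apply/eqP/eqquotP/asboolP.
Qed.

(** The product of classes is defined through chosen representatives; another representative of the
    second factor changes the product by a principal idele only. *)
Lemma idele_classM_pi (a : idele_class F R) (t : idele F R) :
  idele_classM a (\pi_(idele_class F R)%qT t) =
  \pi_(idele_class F R)%qT (ideleM (repr a) t).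
Proof.
apply/eqP/idele_class_eqP.
have /eqP/idele_class_eqP[c pc tE] :
  \pi_(idele_class F R)%qT (repr (\pi_(idele_class F R)%qT t)) =
  \pi_(idele_class F R)%qT t by rewrite reprK.
exists c => //; rewrite [in LHS]tE; apply: idele_eq => /=.
by rewrite mulrCA.
Qed.

Lemma idele_classM_continuous (a : idele_class F R) :
  continuous (idele_classM a).
Proof.
apply/quotient_continuous.
rewrite (_ : _ \o _ = \pi_(idele_class F R)%qT \o ideleM (repr a)).
  move=> t; apply: continuous_comp; first exact: ideleM_continuous.
  exact: pi_continuous.
by apply/funext => t; exact: idele_classM_pi.
Qed.

End Topology.

(** * Integration *)

Section Integral.
Variable R : realType.
Local Notation C := (R[i]^o).

Lemma borel_measurable_fun (G H : ptopologicalType) (f : G -> H) :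
  continuous f -> measurable_fun setT (f : borel G -> borel H).
Proof.
move=> /continuousP cf; apply: (@measurability _ _ (borel G) (borel H) setT f (@open H) erefl).
move=> _ [B oB <-]; rewrite setTI.
exact: sub_sigma_algebra (cf _ oB).
Qed.

Lemma Rintegral_invariant d (T : measurableType d) (mu : {measure set T -> \bar R})
    (h : T -> T) (f : T -> R) : measurable_fun setT h ->
  (forall A, measurable A -> mu (h @^-1` A) = mu A) ->
  mu.-integrable setT (EFin \o f) ->
  mu.-integrable setT (EFin \o (f \o h)) /\
  Rintegral mu setT (f \o h) = Rintegral mu setT f.
Proof.
move=> mh hmu fi.
have mf := measurable_int _ fi.
have ehmu (k : T -> \bar R) : measurable_fun setT k -> (forall x, 0 <= k x)%E ->
    (\int[mu]_x (k (h x)) = \int[mu]_x k x)%E.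
  move=> mk k0; have := @ge0_integral_pushforward _ _ _ _ _ h mh mu setT k.
  rewrite preimage_setT => <- //.
  apply: eq_measure_integral => A mA _; exact: hmu.
have mfh : measurable_fun setT (EFin \o (f \o h)).
  exact: (measurableT_comp mf mh).
split.
  apply/integrableP; split=> //; move/integrableP: fi => [_].
  rewrite -[in X in X -> _]ehmu//. exact: measurableT_comp.
rewrite /Rintegral; congr fine; rewrite integralE [RHS]integralE.
congr (_ - _)%E.
  rewrite (funepos_comp (EFin \o f) h) ehmu//; exact: measurable_funepos.
rewrite (funeneg_comp (EFin \o f) h) ehmu//; exact: measurable_funeneg.
Qed.

(** The measure-preserving right inverse [k] carries integrability of [f \o h] back to [f], so the
    default value 0 is taken on both sides or on neither. *)
Lemma cintegral_invariant d (T : measurableType d) (mu : {measure set T -> \bar R})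
    (h k : T -> T) (f : T -> C) : measurable_fun setT h -> measurable_fun setT k ->
  cancel k h ->
  (forall A, measurable A -> mu (h @^-1` A) = mu A) ->
  (forall A, measurable A -> mu (k @^-1` A) = mu A) ->
  cintegral mu (f \o h) = cintegral mu f.
Proof.
move=> mh mk kK hmu kmu; rewrite /cintegral.
have fK : f = (f \o h) \o k by apply/funext => x /=; rewrite kK.
case: asboolP => [[rei imi]|ni]; case: asboolP => [[rei' imi']|ni'] //.
- by congr (_ +i* _);
    [have [_] := Rintegral_invariant mh hmu rei'
    |have [_] := Rintegral_invariant mh hmu imi'].
- exfalso; apply: ni'.
  have [re _] := Rintegral_invariant mk kmu rei.
  have [im _] := Rintegral_invariant mk kmu imi.
  by split; rewrite fK.
- exfalso; apply: ni.
  have [re _] := Rintegral_invariant mh hmu rei'.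
  by have [im _] := Rintegral_invariant mh hmu imi'.
Qed.

(** Dividing by [c] recovers [f], so [c * f] and [f] are integrable together and the default value 0
    is consistent. *)
Lemma cintegralZ d (T : measurableType d) (mu : {measure set T -> \bar R})
    (c : C) (f : T -> C) : c != 0 ->
  cintegral mu (fun x => c * f x) = c * cintegral mu f.
Proof.
have int (a : C) (g : T -> C) :
    mu.-integrable setT (fun x => (complex.Re (g x))%:E) ->
    mu.-integrable setT (fun x => (complex.Im (g x))%:E) ->
    [/\ mu.-integrable setT (fun x => (complex.Re (a * g x))%:E),
      mu.-integrable setT (fun x => (complex.Im (a * g x))%:E),
      Rintegral mu setT (fun x => complex.Re (a * g x)) =
        complex.Re a * Rintegral mu setT (fun x => complex.Re (g x)) -
        complex.Im a * Rintegral mu setT (fun x => complex.Im (g x)) &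
      Rintegral mu setT (fun x => complex.Im (a * g x)) =
        complex.Re a * Rintegral mu setT (fun x => complex.Im (g x)) +
        complex.Im a * Rintegral mu setT (fun x => complex.Re (g x))].
  move=> ri ii.
  have mul (b : R) (u : T -> R) : mu.-integrable setT (fun x => (u x)%:E) ->
      mu.-integrable setT (fun x => (b * u x)%:E).
    move=> ui; apply: (eq_integrable measurableT (fun x => b%:E * (u x)%:E)%E).
      by move=> x _; rewrite EFinM.
    exact: integrableZl.
  have ReE : (fun x => complex.Re (a * g x)) = (fun x =>
    complex.Re a * complex.Re (g x) - complex.Im a * complex.Im (g x)).
    by apply/funext => x; case: (a) (g x) => [? ?] [? ?].
  have ImE : (fun x => complex.Im (a * g x)) = (fun x =>
    complex.Re a * complex.Im (g x) + complex.Im a * complex.Re (g x)).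
    by apply/funext => x; case: (a) (g x) => [? ?] [? ?].
  split.
  - rewrite (_ : (fun x => _) = (fun x =>
      (complex.Re a * complex.Re (g x))%:E - (complex.Im a * complex.Im (g x))%:E)%E).
      by apply: integrableB => //; exact: mul.
    by apply/funext => x; rewrite -EFinB; case: (a) (g x) => [? ?] [? ?].
  - rewrite (_ : (fun x => _) = (fun x =>
      (complex.Re a * complex.Im (g x))%:E + (complex.Im a * complex.Re (g x))%:E)%E).
      by apply: integrableD => //; exact: mul.
    by apply/funext => x; rewrite -EFinD; case: (a) (g x) => [? ?] [? ?].
  - rewrite ReE RintegralB//; [|exact: mul..].
    by rewrite !RintegralZl.
  - rewrite ImE RintegralD//; [|exact: mul..].
    by rewrite !RintegralZl.
move=> c0; rewrite /cintegral.
case: asboolP => [[rei imi]|ni]; case: asboolP => [[rei' imi']|ni'] //.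
- have [_ _ -> ->] := int c f rei' imi'.
  by case: (c) => a b; apply/eqP; rewrite eq_complex /= !eqxx.
- exfalso; apply: ni'; have [rei' imi' _ _] := int c^-1 _ rei imi.
  have fK x : c^-1 * (c * f x) = f x by rewrite mulKf.
  by split; [apply: eq_integrable rei'|apply: eq_integrable imi'] => // x _;
    rewrite fK.
- by exfalso; apply: ni; have [] := int c _ rei' imi'.
- by rewrite mulr0.
Qed.

End Integral.

(** * The idele norm *)

Section IdeleNorm.
Variables (F : fieldExtType rat) (R : realType).

Lemma finite_roots (p : {poly R}) : p != 0 -> finite_set [set x | root p x].
Proof.
move=> p0; apply: contrapT => /(infinite_set_fset (size p))[B Bp].
apply/negP; rewrite -ltnNge; apply: max_poly_roots p0 _ _; last exact: finmap.fset_uniq.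
by apply/allP => x xB; exact: (Bp x).
Qed.

Lemma rmorph_in_alg (s : {rmorphism F -> R}) (c : rat) : s (c%:A) = ratr c.
Proof. exact: (fmorph_eq_rat (s \o in_alg F)). Qed.

Lemma rmorph_eq (s1 s2 : {rmorphism F -> R}) : s1 =1 s2 -> s1 = s2.
Proof.
case: s1 s2 => [f1 [[a1] [m1]]] [f2 [[a2] [m2]]] /= /funext ff.
subst f2; congr GRing.RMorphism.Pack.
by rewrite (Prop_irrelevance a1 a2) (Prop_irrelevance m1 m2).
Qed.

(** Every real embedding sends [x] to a root of its minimal polynomial over the rationals. *)
Lemma finite_real_place_values (x : F) :
  finite_set [set s x | s in [set: real_place F R]].
Proof.
have /polyOver1P[q qE] := minPolyOver 1%AS x.
have q0 : map_poly ratr q != 0 :> {poly R}.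
  rewrite map_poly_eq0; apply: contraTneq (monic_minPoly 1%AS x) => q0.
  by rewrite qE q0 rmorph0 monicE lead_coef0 eq_sym oner_eq0.
apply: sub_finite_set (finite_roots q0) => _ [s _ <-] /=.
have := root_minPoly 1%AS x; rewrite qE -(fmorph_root s) -map_poly_comp.
rewrite (eq_map_poly (g := ratr))// => c; exact: rmorph_in_alg.
Qed.

(** An embedding is determined by its values on a rational basis of [F], and each basis vector has
    finitely many possible values. *)
Lemma finite_real_place : finite_set [set: real_place F R].
Proof.
pose b : seq F := vbasis {:F}.
have fin (l : seq F) :
    finite_set [set [seq s x | x <- l] | s in [set: real_place F R]].
  elim: l => [|x l IHl].
    by apply: (@sub_finite_set _ _ [set [::]]) => // _ [s _ <-].
  apply: sub_finite_set (finite_image2 cons (finite_real_place_values x) IHl).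
  by move=> _ [s _ <-] /=; exists (s x); [exists s|exists (map s l) => //; exists s].
rewrite -(eq_finite_set (inj_card_eq (f := fun s : real_place F R => map s b) _)).
  exact: fin.
move=> s1 s2 _ _ s12; apply: rmorph_eq => x.
rewrite (coord_vbasis (memvf x)) !rmorph_sum; apply: eq_bigr => i _.
rewrite -mulr_algl !rmorphM/= !rmorph_in_alg; congr (_ * _).
have ib : (i < size b)%N by rewrite size_tuple.
by rewrite -!(nth_map _ 0 _ ib) s12.
Qed.

(** Where both [t] and its inverse are integral, two absolute values at most 1 have product 1, so
    both equal 1. *)
Lemma finite_idele_cabs_neq1 (t : idele F R) :
  finite_set [set p | cabs ((idele_val t).2 p) <> 1].
Proof.
apply: (@sub_finite_set _ _ ([set p | ~ local_ring ((idele_val t).2 p)] `|`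
  [set p | ~ local_ring ((idele_inv t).2 p)])); last first.
  by rewrite finite_setU; split; exact: fadeleP.
move=> p /= t1; apply: contrapT => /not_orP[/contrapT a1 /contrapT b1].
apply: t1; apply/eqP; rewrite eq_le a1/=.
have ab : cabs ((idele_val t).2 p) * cabs ((idele_inv t).2 p) = 1.
  by rewrite -cabsM -[_ * _]/((idele_val t * idele_inv t).2 p) idele_mulV cabs1.
by rewrite -[leLHS]ab ler_piMr ?cabs_ge0.
Qed.

Lemma idele_normM (t u : idele F R) :
  idele_norm (ideleM t u) = idele_norm t * idele_norm u.
Proof.
rewrite /idele_norm mulrACA; congr (_ * _).
  rewrite -fsbig_split; last exact: finite_real_place.
  by apply: eq_fsbigr => s _; exact: normrM.
pose A := [set p : finite_place F R | cabs ((idele_val t).2 p) <> 1] `|`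
  [set p | cabs ((idele_val u).2 p) <> 1].
have fA : finite_set A.
  by rewrite finite_setU; split; exact: finite_idele_cabs_neq1.
have nA p : ~ A p -> cabs ((idele_val t).2 p) = 1 /\ cabs ((idele_val u).2 p) = 1.
  by move=> /not_orP[/contrapT ? /contrapT].
(* The three products have different supports; all are rewritten over the common finite set [A]
   before being combined. *)
rewrite -(fsbig_widen A)//; last first.
  by move=> p [_ /nA[t1 u1]] /=; rewrite cabsM t1 u1 mulr1.
rewrite -[X in _ = X * _](fsbig_widen A)//; last first.
  by move=> p [_ /nA[]].
rewrite -[X in _ = _ * X](fsbig_widen A)//; last first.
  by move=> p [_ /nA[]].
rewrite -fsbig_split//; apply: eq_fsbigr => p _; exact: cabsM.
Qed.

Lemma idele_norm_gt0 (t : idele F R) : 0 < idele_norm t.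
Proof.
have tV := idele_mulV t.
apply: mulr_gt0; apply: prodr_gt0 => s _.
  rewrite normr_gt0; apply/eqP => ts0.
  have : (idele_val t * idele_inv t).1 s = 0 by rewrite -[LHS]/(_ * _) ts0 mul0r.
  by rewrite tV => /eqP; rewrite oner_eq0.
rewrite lt_neqAle cabs_ge0 andbT eq_sym; apply/eqP => ts0.
have : cabs ((idele_val t * idele_inv t).2 s) = 0.
  by rewrite -[X in cabs X]/(_ * _) cabsM ts0 mul0r.
by rewrite tV -[X in cabs X]/1 cabs1 => /eqP; rewrite oner_eq0.
Qed.

End IdeleNorm.

(** * Exponent laws for complex powers of positive reals *)

Section ComplexPower.
Variable R : realType.
Local Notation C := (R[i]^o).

Lemma cpowM (a b : R) (s : C) : 0 < a -> 0 < b ->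
  cpow (a * b) s = cpow a s * cpow b s.
Proof.
move=> a0 b0; rewrite /cpow lnM ?posrE// !mulrDr expRD cosD sinD.
by apply/eqP; rewrite eq_complex /=; apply/andP; split; apply/eqP; ring.
Qed.

Lemma cpowD (a : R) (s s' : C) : cpow a (s + s') = cpow a s * cpow a s'.
Proof.
rewrite /cpow; case: s s' => [x y] [x' y'] /=; rewrite !mulrDl expRD cosD sinD.
by apply/eqP; rewrite eq_complex /=; apply/andP; split; apply/eqP; ring.
Qed.

Lemma cpow0 (a : R) : cpow a 0 = 1.
Proof.
by rewrite /cpow /= !mul0r expR0 cos0 sin0; apply/eqP; rewrite eq_complex /=;
  apply/andP; split; apply/eqP; ring.
Qed.

End ComplexPower.

(** * Translation by a scalar matrix *)

Section Translation.
Variables (F : fieldExtType rat) (R : realType).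
Local Notation C := (R[i]^o).
Local Notation cls t := (\pi_(idele_class F R)%qT t).

Lemma ideleMVK (t u : idele F R) : ideleM (ideleV t) (ideleM t u) = u.
Proof. by apply: idele_eq; rewrite /= mulrA idelV_subproof mul1r. Qed.

Lemma ideleMKV (t u : idele F R) : ideleM t (ideleM (ideleV t) u) = u.
Proof. by apply: idele_eq; rewrite /= mulrA idele_mulV mul1r. Qed.

Lemma repr_idele_class (t : idele F R) :
  exists2 c, principal_idele c & repr (cls t) = ideleM c t.
Proof. by apply/idele_class_eqP; rewrite reprK. Qed.

Lemma idele_classM_pi2 (t u : idele F R) :
  idele_classM (cls t) (cls u) = cls (ideleM t u).
Proof.
rewrite idele_classM_pi; apply/esym/eqP/idele_class_eqP.
have [c pc ->] := repr_idele_class t.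
by exists c => //; apply: idele_eq; rewrite /= mulrA.
Qed.

Lemma idele_classMK (t : idele F R) :
  cancel (idele_classM (cls t)) (idele_classM (cls (ideleV t))).
Proof.
move=> q; rewrite -[q]reprK (idele_classM_pi2 t (repr q)).
by rewrite idele_classM_pi2 ideleMVK.
Qed.

Lemma idele_classMVK (t : idele F R) :
  cancel (idele_classM (cls (ideleV t))) (idele_classM (cls t)).
Proof.
move=> q; rewrite -[q]reprK (idele_classM_pi2 (ideleV t) (repr q)).
by rewrite idele_classM_pi2 ideleMKV.
Qed.

(** This is the substitution [t = z u] on idele classes. It holds without any invariance or
    convergence assumption on [f], because the conventions giving 0 apply to [f] and [f']
    simultaneously. *)
Lemma class_integral_translate
    (nu : {measure set (borel (idele_class F R)) -> \bar R}) (z : idele F R)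
    (c : C) (f f' : idele F R -> C) :
  is_haar (@idele_classM F R) nu -> c != 0 ->
  (forall t, f' t = c * f (ideleM (ideleV z) t)) ->
  class_integral nu f' = c * class_integral nu f.
Proof.
move=> nu_haar c0 f'E; rewrite /class_integral.
have mulVC d t : ideleM (ideleV z) (ideleM d t) = ideleM d (ideleM (ideleV z) t).
  by apply: idele_eq; rewrite /= mulrCA.
have [finv|fninv] := asboolP (forall d t, principal_idele d ->
    f (ideleM d t) = f t); last first.
  (* Translating back by [z] and cancelling [c] would transfer invariance from [f'] to [f]; so if
     [f] does not descend to classes, neither does [f']. *)
  rewrite mulr0; case: asboolP => // f'inv; exfalso; apply: fninv => d t pd.
  apply: (mulfI c0); rewrite -[in LHS](ideleMVK z t) -mulVC -f'E f'inv//.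
  by rewrite f'E ideleMVK.
rewrite asboolT; last by move=> d t pd; rewrite !f'E mulVC finv.
have mcls (a : idele_class F R) : measurable_fun setT
    (idele_classM a : borel (idele_class F R) -> borel (idele_class F R)).
  exact: (@borel_measurable_fun (idele_class F R) (idele_class F R) _
    (@idele_classM_continuous F R a)).
have inv (t u : idele F R) :
    cancel (idele_classM (cls t)) (idele_classM (cls u)) ->
    cancel (idele_classM (cls u)) (idele_classM (cls t)) ->
    forall A : set (borel (idele_class F R)), measurable A ->
    nu (idele_classM (cls t) @^-1` A) = nu A.
  (* Haar invariance concerns images, so the preimage under one translation is rewritten as the
     image under the inverse translation. *)
  move=> tK uK A mA; rewrite -[RHS](haar_invariant nu_haar (cls u) mA).
  congr (nu _); apply/seteqP; split=> q /=.
    by move=> Aq; exists (idele_classM (cls t) q).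
  by move=> [r Ar <-]; rewrite uK.
pose h (q : borel (idele_class F R)) : C := f (repr (q : idele_class F R)).
pose T (q : borel (idele_class F R)) : borel (idele_class F R) :=
  idele_classM (cls (ideleV z)) q.
transitivity (c * cintegral nu (h \o T)); last first.
  congr (c * _).
  apply: (@cintegral_invariant _ _ _ nu T (idele_classM (cls z)) h (mcls _)
    (mcls _) (idele_classMK z)).
    exact: inv (idele_classMVK z) (idele_classMK z).
  exact: inv (idele_classMK z) (idele_classMVK z).
rewrite -cintegralZ//; congr (cintegral nu _); apply/funext => q.
rewrite /h /T /= f'E -{2}[q]reprK idele_classM_pi2.
(* The representative of the translated class differs from the translated representative by a
   principal idele [d], which [f] ignores. *)
have [d pd ->] := repr_idele_class (ideleM (ideleV z) (repr q)).
by rewrite (finv d).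
Qed.

(** Theta sees a matrix only through its inverse, so group identities need checking only on the
    stored inverses. *)
Lemma eq_theta (phi : 'cV[adele F R]_2 -> C) (g h : gl2 F R) :
  gl2_inv g = gl2_inv h -> theta phi g = theta phi h.
Proof. by rewrite /theta => ->. Qed.

Lemma theta_scalarM (phi : 'cV[adele F R]_2 -> C) (z t : idele F R) (g : gl2 F R) :
  theta phi (gl2M (gl2_scalar (ideleV t)) (gl2M (gl2_scalar z) g)) =
  theta phi (gl2M (gl2_scalar (ideleV (ideleM (ideleV z) t))) g).
Proof. by apply: eq_theta; rewrite /= -mulmxA -scalar_mxM. Qed.

Lemma gl2_det_scalarM (z : idele F R) (g : gl2 F R) :
  gl2_det (gl2M (gl2_scalar z) g) = ideleM (ideleM z z) (gl2_det g).
Proof. by apply: idele_eq; rewrite /= det_mulmx det_scalar expr2. Qed.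

Lemma cpow_idele_normM (t u : idele F R) (s : C) :
  cpow (idele_norm (ideleM t u)) s = cpow (idele_norm t) s * cpow (idele_norm u) s.
Proof. by rewrite idele_normM cpowM ?idele_norm_gt0. Qed.

Lemma cpow_idele_normMN (t : idele F R) (s : C) :
  cpow (idele_norm t) (- s) * cpow (idele_norm t) s = 1.
Proof. by rewrite -cpowD addNr cpow0. Qed.

Definition eisenstein_integrand (w : idele F R -> C)
    (phi : 'cV[adele F R]_2 -> C) (g : gl2 F R) (s : C) (t : idele F R) : C :=
  w t * cpow (idele_norm t) (2 * s) *
    theta phi (gl2M (gl2_scalar (ideleV t)) g).

Lemma eisenstein_integrand_scalarM (w : idele F R -> C)
    (phi : 'cV[adele F R]_2 -> C) (z : idele F R) (g : gl2 F R) (s : C)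
    (t : idele F R) : is_unitary_hecke w ->
  eisenstein_integrand w phi (gl2M (gl2_scalar z) g) s t =
  w z * cpow (idele_norm z) (2 * s) *
    eisenstein_integrand w phi g s (ideleM (ideleV z) t).
Proof.
move=> hw; rewrite /eisenstein_integrand theta_scalarM.
set th := theta _ _.
have {1}-> : w t = w z * w (ideleM (ideleV z) t).
  by rewrite -(heckeM hw) ideleMKV.
have {1}-> : cpow (idele_norm t) (2 * s) = cpow (idele_norm z) (2 * s) *
    cpow (idele_norm (ideleM (ideleV z) t)) (2 * s).
  by rewrite -cpow_idele_normM ideleMKV.
by rewrite [X in X * th = _]mulrACA !mulrA.
Qed.

Lemma eisenstein_integralE
    (nu : {measure set (borel (idele_class F R)) -> \bar R})
    (w : idele F R -> C) (phi : 'cV[adele F R]_2 -> C) (g : gl2 F R) (s : C) :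
  eisenstein_integral nu w phi g s = cpow (idele_norm (gl2_det g)) (- s) *
    class_integral nu (eisenstein_integrand w phi g s).
Proof. by []. Qed.

(** The factor [|z|^(2s)] from the substitution cancels against [|z|^(-2s)] from the determinant.
    The identity holds at every [s], convergent or not, thanks to the default value 0. *)
Lemma eisenstein_integral_scalarM
    (nu : {measure set (borel (idele_class F R)) -> \bar R})
    (w : idele F R -> C) (phi : 'cV[adele F R]_2 -> C) (z : idele F R)
    (g : gl2 F R) (s : C) :
  is_haar (@idele_classM F R) nu -> is_unitary_hecke w ->
  eisenstein_integral nu w phi (gl2M (gl2_scalar z) g) s =
  w z * eisenstein_integral nu w phi g s.
Proof.
move=> nu_haar hw.
have wz0 : w z != 0 by rewrite -normr_eq0 (hecke_unitary hw) oner_eq0.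
have cpowV := cpow_idele_normMN z (2 * s).
have cz0 : cpow (idele_norm z) (2 * s) != 0.
  apply/eqP => c0; move: cpowV; rewrite c0 mulr0 => /esym/eqP.
  by rewrite oner_eq0.
have fE t := eisenstein_integrand_scalarM phi z g s t hw.
have intE := class_integral_translate nu_haar (mulf_neq0 wz0 cz0) fE.
have detE : cpow (idele_norm (gl2_det (gl2M (gl2_scalar z) g))) (- s) =
    cpow (idele_norm z) (- (2 * s)) * cpow (idele_norm (gl2_det g)) (- s).
  rewrite gl2_det_scalarM (cpow_idele_normM (ideleM z z)).
  by rewrite (cpow_idele_normM z z) -cpowD -opprD mulrDl mul1r.
apply: etrans (congr2 *%R detE intE) _.
rewrite (eisenstein_integralE nu w phi g s).
(* All factors become variables: only commutative ring algebra and the cancellation [a * b = 1]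
   remain. *)
move: cpowV; move: (cpow (idele_norm z) (- (2 * s))) => a.
move: (cpow (idele_norm z) (2 * s)) (cpow _ (- s)) => b d.
move: (class_integral _ _) (w z) => I c ab1.
have -> : a * d * (c * b * I) = a * b * (c * (d * I)) by ring.
by rewrite ab1 mul1r.
Qed.

End Translation.

Theorem mainTheorem5 (R : realType) (F : fieldExtType rat)
  (F_totally_real : totally_real R F)
  (mu : {measure set (borel (idele F R)) -> \bar R})
  (mu_haar : is_haar (@ideleM F R) mu)
  (nu : {measure set (borel (idele_class F R)) -> \bar R})
  (nu_quotient : is_quotient_measure mu nu)
  (w : idele F R -> R[i]^o) (w_hecke : is_unitary_hecke w)
  (phi : 'cV[adele F R]_2 -> R[i]^o) (phi_sb : is_schwartz_bruhat phi)
  (z : idele F R) (g : gl2 F R) :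
  meromorphic_eq (eisenstein nu w phi (gl2M (gl2_scalar z) g))
    (fun s => w z * eisenstein nu w phi g s).
Proof.
apply: meromorphic_continuationZ.
  by rewrite -normr_eq0 (hecke_unitary w_hecke) oner_eq0.
move=> s _; exact: eisenstein_integral_scalarM nu_quotient.1 w_hecke.
Qed.
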